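(* Let $m\in(2,\infty)$ be real (in particular any integer dimension $m>2$). The spectral functions $K_{\Delta_k}(\cdot;m)$ and $H_{\Delta_k}(\cdot,\cdot;m)$ of the modular curvature, given in the context in terms of hypergeometric functions, have the explicit forms $$K_{\Delta_k}(s;m)=\frac{-8\,s^{-m/2}\Big((m(s-1)-4s)\,s^{m/2}+s\,(m(s-1)+4)\Big)\Gamma(\frac m2+2)}{(m-2)\,m^2\,(m+2)\,(s-1)^3}$$ for $s>0$, $s\neq1$, and $$H_{\Delta_k}(s,t;m)=\frac{2\,\Gamma(\frac m2-1)}{m\,(s-1)^2(t-1)^2(st-1)^3}\Big[2s^{-m/2}(st-1)^3+2(t-1)^2\big(\tfrac m2(s-1)(st-1)+s(1-2s)t+1\big)-2(s-1)^2\,t\,(st)^{-m/2}\big(\tfrac m2(t-1)(st-1)+st^2+t-2\big)\Big]$$ for $s,t>0$ with $s\ne1$, $t\neq1$, $st\neq1$.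
   Context: For $s,t>0$ and real $m>2$, $$K_{\Delta_k}(s;m)=-\tfrac12\Gamma(\tfrac m2+1)\,{}_2F_1(\tfrac m2+1,1;3;1-s)+\tfrac{2}{3m}\Gamma(\tfrac m2+2)\,{}_2F_1(\tfrac m2+2,1;4;1-s),$$ $$H_{\Delta_k}(s,t;m)=\tfrac1{6m}\Big[2(m+2)\Gamma(\tfrac m2+2)F_1(\tfrac m2+2;1,1;4;1-st,1-s)-2\Gamma(\tfrac m2+3)F_1(\tfrac m2+3;1,1;5;1-st,1-s)-s\,\Gamma(\tfrac m2+3)F_1(\tfrac m2+3;1,2;5;1-st,1-s)\Big],$$ with ${}_2F_1$ Gauss's hypergeometric function and $F_1$ Appell's first function, given for real $x,y<1$ by $$F_1(\alpha;\beta,\beta';\gamma;x,y)=\frac{\Gamma(\gamma)}{\Gamma(\beta)\Gamma(\beta')\Gamma(\gamma-\beta-\beta')}\int_{p,q\ge0,\,p+q\le1}p^{\beta-1}q^{\beta'-1}(1-p-q)^{\gamma-\beta-\beta'-1}(1-xp-yq)^{-\alpha}dp\,dq.$$ *)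

(* Defs.v *)
From HB Require Import structures.
From mathcomp Require Export all_boot all_order all_algebra.
From mathcomp Require Export all_classical all_reals all_analysis.

Set Implicit Arguments.
Unset Strict Implicit.
Unset Printing Implicit Defensive.

Import Order.TTheory GRing.Theory Num.Theory.
Import numFieldNormedType.Exports.

Local Open Scope classical_set_scope.
Local Open Scope ring_scope.

(* Meaningful for 0 < z, where the integral converges. *)
Definition Gamma (R : realType) (z : R) : R :=
  \int[@lebesgue_measure R]_(u in `]0, +oo[) (u `^ (z - 1) * expR (- u)).

Definition pochhammer (R : realType) (a : R) (n : nat) : R :=
  \prod_(i < n) (a + i%:R).

Definition gauss_coef (R : realType) (a b c : R) (n : nat) : R :=
  pochhammer a n * pochhammer b n / (pochhammer c n * n`!%:R).

Definition real_analytic_at (R : realType) (f : R -> R) (x0 : R) : Prop :=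
  exists (u : nat -> R) (r : R), 0 < r /\
    forall h : R, `|h| < r -> pseries u h n @[n --> \oo] --> f (x0 + h).

(* The Gauss series only converges on ]-1, 1[; for x <= -1 the value of 2F1 is
   its analytic continuation along the negative real axis, which is unique
   because ]-oo, 1[ is connected. Values of F on [1, +oo[ are unconstrained. *)
Definition is_gauss_2F1 (R : realType) (a b c : R) (F : R -> R) : Prop :=
  (forall x : R, `|x| < 1 ->
     pseries (gauss_coef a b c) x n @[n --> \oo] --> F x) /\
  (forall x : R, x < 1 -> real_analytic_at F x).

(* Meaningful for x < 1 and c not a nonpositive integer. *)
Definition hyp2F1 (R : realType) (a b c x : R) : R :=
  xget 0 [set y : R | exists2 F : R -> R, is_gauss_2F1 a b c F & F x = y].

Definition simplex2 (R : realType) : set (R * R) :=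
  [set z | [/\ 0 <= z.1, 0 <= z.2 & z.1 + z.2 <= 1]].

(* Meaningful for b, b', g - b - b' > 0 and x, y < 1. *)
Definition appellF1 (R : realType) (a b b' g x y : R) : R :=
  Gamma g / (Gamma b * Gamma b' * Gamma (g - b - b')) *
  \int[(@lebesgue_measure R \x @lebesgue_measure R)%E]_(z in @simplex2 R)
     (z.1 `^ (b - 1) * z.2 `^ (b' - 1) *
      (1 - z.1 - z.2) `^ (g - b - b' - 1) *
      (1 - x * z.1 - y * z.2) `^ (- a)).

Definition K_Delta_k (R : realType) (s m : R) : R :=
  - (1 / 2) * Gamma (m / 2 + 1) * hyp2F1 (m / 2 + 1) 1 3 (1 - s)
  + 2 / (3 * m) * Gamma (m / 2 + 2) * hyp2F1 (m / 2 + 2) 1 4 (1 - s).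

Definition H_Delta_k (R : realType) (s t m : R) : R :=
  1 / (6 * m) *
  (2 * (m + 2) * Gamma (m / 2 + 2)
     * appellF1 (m / 2 + 2) 1 1 4 (1 - s * t) (1 - s)
   - 2 * Gamma (m / 2 + 3)
     * appellF1 (m / 2 + 3) 1 1 5 (1 - s * t) (1 - s)
   - s * Gamma (m / 2 + 3)
     * appellF1 (m / 2 + 3) 1 2 5 (1 - s * t) (1 - s)).

(* Main.v *)
Require Import Defs.
From mathcomp Require Import measurable_realfun ring lra.

Import Order.TTheory GRing.Theory Num.Theory.
Import numFieldNormedType.Exports.
Local Open Scope classical_set_scope.
Local Open Scope ring_scope.

(** Put q = m / 2 - 1, so that q > 0. Every special function in K and H is an
    explicit linear combination of values of the single function u^(-q) and of
    its derivatives, and the two identities are then identities between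
    rational functions.

    For K: since (q + k)_n = (q)_(k + n) / (q)_k and (k + 1)_n = (k + n)! / k!,
    the Gauss series of 2F1(q + k, 1; k + 1; x) is, up to the factor
    k! / (q)_k, the binomial series of (1 - x)^(-q) with its first k terms
    removed and divided by x^k ([gauss_coef_binom]). The binomial series is
    summed by its differential equation ([binom_series_cvg]). This determines
    2F1 on ]-1, 1[. The values 2F1(.; 1 - s) with s >= 2 lie further left and
    are defined by analytic continuation, so one has to know that
    (1 - x)^(-q) is real analytic on ]-oo, 1[, that removing the constant term
    and dividing by x preserves this ([analytic_extension_tail]), and that an
    analytic continuation is unique ([real_analytic_identity]). The outcome
    is [hyp2F1_closed_form].

    For H: the weights in the three Appell integrals are polynomials of degree
    at most 2, and the power of the affine form L = 1 - x p - y r is a constant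
    times a derivative of u^(-q) at u = L. By Tonelli the integral over the
    triangle is iterated, and both one-dimensional integrals are computed by
    repeated integration by parts, that is, by exhibiting primitives
    ([simplex_integral_linear], [simplex_integral_quadratic]). The boundary
    terms only involve u^(-q) and its derivatives at the values 1, 1 - x = s t
    and 1 - y = s of L at the vertices of the triangle; this is the
    Hermite-Genocchi formula for divided differences with repeated nodes, and
    it explains the denominators in the result.

    The Gamma factors are all reduced to Gamma(q) by the functional equation
    ([Gamma_rec]). *)

Set Implicit Arguments.
Unset Strict Implicit.
Unset Printing Implicit Defensive.

(** * Partial sums of power series *)

Lemma pseriesS (R : realType) (u : nat -> R) (x : R) n :
  pseries u x n.+1 = pseries u x n + u n * x ^+ n.
Proof. by rewrite /pseries/series/= big_nat_recr. Qed.

Lemma pseries0 (R : realType) (u : nat -> R) (x : R) : pseries u x 0 = 0.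
Proof. by rewrite /pseries/series/= big_geq. Qed.

Lemma pseries_tailE (R : realType) (u : nat -> R) (x : R) n :
  pseries u x n.+1 = u 0%N + x * pseries (fun k => u k.+1) x n.
Proof.
elim: n => [|n IHn]; first by rewrite pseriesS !pseries0 expr0; ring.
by rewrite pseriesS IHn pseriesS exprS; ring.
Qed.

Lemma pseriesZ (R : realType) (k : R) (u : nat -> R) (x : R) n :
  pseries (fun i => k * u i) x n = k * pseries u x n.
Proof.
elim: n => [|n IHn]; first by rewrite !pseries0 mulr0.
by rewrite !pseriesS IHn; ring.
Qed.

Lemma cvgn_ext (R : realType) (u v : nat -> R) (l : R) :
  u =1 v -> u n @[n --> \oo] --> l -> v n @[n --> \oo] --> l.
Proof. by move=> /funext ->. Qed.

Lemma cvg_pseries_at0 (R : realType) (u : nat -> R) :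
  pseries u 0 n @[n --> \oo] --> u 0%N.
Proof.
rewrite -(cvg_shiftS (pseries u 0)); apply: cvg_near_cst; apply: nearW => n /=.
by rewrite pseries_tailE mul0r addr0.
Qed.

Lemma cvg_pseries_tail (R : realType) (u : nat -> R) (x l : R) : x != 0 ->
  pseries u x n @[n --> \oo] --> l ->
  pseries (fun k => u k.+1) x n @[n --> \oo] --> (l - u 0%N) / x.
Proof.
move=> x0 ul.
apply: (@cvgn_ext _ (fun n => (pseries u x n.+1 - u 0%N) / x)).
  by move=> n; rewrite pseries_tailE; field.
apply: cvgM; last exact: cvg_cst.
by apply: cvgB; [rewrite (cvg_shiftS (pseries u x))|exact: cvg_cst].
Qed.

Lemma pseries_bounded (R : realType) (u : nat -> R) (x l : R) :
  pseries u x n @[n --> \oo] --> l ->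
  exists2 C, 0 < C & forall n, `|u n * x ^+ n| <= C.
Proof.
move=> /cvgP/cvg_series_bounded[M [_ uM]].
exists (Num.max M 0 + 1) => [|n]; first by rewrite ltr_pwDr// le_max lexx orbT.
have /(_ _)/= := uM (Num.max M 0 + 1) _ n I; apply.
by rewrite (@le_lt_trans _ _ (Num.max M 0)) ?ltrDl// le_max lexx.
Qed.

(** * The binomial series *)

Lemma pochhammerS (R : realType) (a : R) n :
  pochhammer a n.+1 = pochhammer a n * (a + n%:R).
Proof. by rewrite /pochhammer big_ord_recr. Qed.

Lemma pochhammer0 (R : realType) (a : R) : pochhammer a 0 = 1.
Proof. by rewrite /pochhammer big_ord0. Qed.

Lemma pochhammerD (R : realType) (a : R) m n :
  pochhammer a (m + n) = pochhammer a m * pochhammer (a + m%:R) n.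
Proof.
elim: n => [|n IHn]; first by rewrite addn0 pochhammer0 mulr1.
by rewrite addnS !pochhammerS IHn natrD addrA mulrA.
Qed.

Lemma pochhammer_fact (R : realType) n : pochhammer (1 : R) n = n`!%:R.
Proof.
elim: n => [|n IHn]; first by rewrite pochhammer0.
by rewrite pochhammerS IHn factS natrM nat1r mulrC.
Qed.

Lemma pochhammer_gt0 (R : realType) (a : R) n : 0 < a -> 0 < pochhammer a n.
Proof. by move=> a0; apply: prodr_gt0 => i _; rewrite ltr_wpDr. Qed.

(** The coefficients of (1 - x)^(-p). *)
Definition binom_coef (R : realType) (p : R) (n : nat) : R :=
  pochhammer p n / n`!%:R.

Lemma binom_coef0 (R : realType) (p : R) : binom_coef p 0 = 1.
Proof. by rewrite /binom_coef pochhammer0 divr1. Qed.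

Lemma binom_coefS (R : realType) (p : R) n :
  binom_coef p n.+1 = binom_coef p n * ((p + n%:R) / n.+1%:R).
Proof.
rewrite /binom_coef pochhammerS factS natrM.
have h1 : n`!%:R != 0 :> R by rewrite pnatr_eq0 -lt0n fact_gt0.
have h2 : n%:R + 1 != 0 :> R by rewrite natr1 pnatr_eq0.
by rewrite -natr1; field; rewrite h1 h2.
Qed.

Lemma binom_coef_gt0 (R : realType) (p : R) n : 0 < p -> 0 < binom_coef p n.
Proof.
by move=> p0; rewrite divr_gt0 ?pochhammer_gt0// ltr0n fact_gt0.
Qed.

Lemma binom_coef_pascal (R : realType) (p : R) n :
  binom_coef (p + 1) n.+1 = binom_coef (p + 1) n + binom_coef p n.+1.
Proof.
rewrite /binom_coef pochhammerS [pochhammer p n.+1](pochhammerD p 1 n).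
rewrite pochhammerS pochhammer0 mul1r addr0 factS natrM -natr1.
have h1 : n`!%:R != 0 :> R by rewrite pnatr_eq0 -lt0n fact_gt0.
have h2 : n%:R + 1 != 0 :> R by rewrite natr1 pnatr_eq0.
by field; rewrite h1 h2.
Qed.

Lemma binom_coef_diff (R : realType) (p : R) n :
  n.+1%:R * binom_coef p n.+1 = p * binom_coef (p + 1) n.
Proof.
rewrite /binom_coef [pochhammer p n.+1](pochhammerD p 1 n).
rewrite pochhammerS pochhammer0 mul1r addr0 factS natrM -natr1.
have h1 : n`!%:R != 0 :> R by rewrite pnatr_eq0 -lt0n fact_gt0.
have h2 : n%:R + 1 != 0 :> R by rewrite natr1 pnatr_eq0.
by field; rewrite h1 h2.
Qed.

Lemma pseries_diffs_binom (R : realType) (k p : R) :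
  pseries_diffs (k *: binom_coef p) = (k * p) *: binom_coef (p + 1).
Proof.
apply/funext => n; rewrite /pseries_diffs.
rewrite -[LHS]/(n.+1%:R * (k * _)) -[RHS]/(k * p * _).
by rewrite mulrCA binom_coef_diff mulrA.
Qed.

Lemma ratio_test_cvg (R : realType) (a : nat -> R) (r : R) (N : nat) :
  (forall n, 0 <= a n) -> r < 1 ->
  (forall n, (N <= n)%N -> a n.+1 <= r * a n) -> cvgn (series a).
Proof.
move=> a0 r1 ar.
(* r may be negative, and then a vanishes from N.+1 on. *)
have r0 : 0 <= Num.max r 0 by rewrite le_max lexx orbT.
have {}ar n : (N <= n)%N -> a n.+1 <= Num.max r 0 * a n.
  by move=> Nn; rewrite (le_trans (ar n Nn))// ler_wpM2r// le_max lexx.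
suff : cvgn (series (fun n => a (n + N)%N)).
  move=> h; rewrite -(is_cvg_series_restrict N).
  move: h => /cvg_ex[l hl]; apply/cvg_ex; exists l.
  rewrite -(cvg_shiftn N); apply: cvg_trans hl; apply: near_eq_cvg.
  apply: nearW => n /=.
  have E : \sum_(N <= k < n + N) a k = series (fun n => a (n + N)%N) n.
    by rewrite -{1}[N]add0n big_addn addnK.
  exact: esym E.
apply: (@series_le_cvg _ _ (geometric (a N) (Num.max r 0))) => //.
- by move=> n; rewrite /= mulr_ge0// exprn_ge0.
- elim=> [|n IHn]; first by rewrite /= expr0 mulr1.
  rewrite addSn (le_trans (ar _ (leq_addl _ _)))//=.
  by rewrite exprS mulrCA ler_wpM2l.
- by apply: is_cvg_geometric_series; rewrite ger0_norm// gt_max r1 ltr01.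
Qed.

(** The ratio of consecutive terms tends to |x|, so it is eventually below any
    r in ]|x|, 1[; here r is the midpoint. *)
Lemma is_cvg_binom_series (R : realType) (p x : R) : 0 < p -> `|x| < 1 ->
  cvgn (pseries (binom_coef p) x).
Proof.
move=> p0 x1; apply: normed_cvg; rewrite /normed_series_of/=.
pose r := (1 + `|x|) / 2.
have r1 : r < 1 by rewrite /r; lra.
have xr : `|x| < r by rewrite /r; lra.
pose N := (Num.truncn (p / (r - `|x|))).+1.
apply: (@ratio_test_cvg _ _ r N) => // n Nn.
have nbig : p <= n%:R * (r - `|x|).
  rewrite -ler_pdivrMr ?subr_gt0// (le_trans (ltW (truncnS_gt _)))//.
  by rewrite ler_nat.
have normE k : `|binom_coef p k * x ^+ k| = binom_coef p k * `|x| ^+ k.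
  by rewrite normrM normrX gtr0_norm ?binom_coef_gt0.
rewrite !normE binom_coefS exprS.
have -> : binom_coef p n * ((p + n%:R) / n.+1%:R) * (`|x| * `|x| ^+ n) =
   ((p + n%:R) / n.+1%:R * `|x|) * (binom_coef p n * `|x| ^+ n) by ring.
rewrite ler_wpM2r//; first by rewrite mulr_ge0 ?exprn_ge0// ltW ?binom_coef_gt0.
rewrite mulrAC ler_pdivrMr ?ltr0n// -natr1.
have := ler_wpM2l (ltW p0) (ltW x1).
have := normr_ge0 x.
have : 0 <= n%:R :> R by [].
move: nbig; nra.
Qed.

Lemma is_derive_affine_comp (R : realType) (f : R -> R) (c d x df : R) :
  is_derive (c + d * x) 1 f df ->
  is_derive x 1 (fun z => f (c + d * z)) (d * df).
Proof.
move=> h; rewrite mulrC.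
apply: (@is_derive1_comp _ f (fun z => c + d * z)) => //.
by apply: is_derive_eq; rewrite add0r mul1r /GRing.scale/= mulr1.
Qed.

Definition binom_sum (R : realType) (p x : R) : R :=
  limn (pseries (binom_coef p) x).

Lemma is_derive_binom_sum (R : realType) (p x : R) : 0 < p -> `|x| < 1 ->
  is_derive x 1 (binom_sum p) (p * binom_sum (p + 1) x).
Proof.
move=> p0 x1.
have pZ (k : R) u y : pseries (k *: u) y = k *: pseries u y.
  by apply/funext => n; exact: pseriesZ.
have p1 : 0 < p + 1 by rewrite addr_gt0.
have p2 : 0 < p + 1 + 1 by rewrite addr_gt0.
pose K := (1 + `|x|) / 2.
have K1 : `|K| < 1 by rewrite ger0_norm /K; have := normr_ge0 x; lra.
have xK : `|x| < `|K| by rewrite (@ger0_norm _ K) /K; have := normr_ge0 x; lra.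
have -> : p * binom_sum (p + 1) x =
    limn (pseries (pseries_diffs (binom_coef p)) x).
  rewrite -[binom_coef p]scale1r pseries_diffs_binom mul1r pZ.
  by apply/esym/cvg_lim => //; apply: cvgZl_tmp; exact: is_cvg_binom_series.
have cvgK k q : 0 < q -> cvgn (pseries (k *: binom_coef q) K).
  by move=> q0; rewrite pZ; apply: is_cvgZl_tmp; exact: is_cvg_binom_series.
apply: (@pseries_snd_diffs _ _ K) => //; rewrite -[binom_coef p]scale1r.
- exact: cvgK.
- by rewrite pseries_diffs_binom; exact: cvgK.
- by rewrite !pseries_diffs_binom; exact: cvgK.
Qed.

(** The coefficient rule [binom_coef_pascal], summed. *)
Lemma binom_sum_pascal (R : realType) (p x : R) : 0 < p -> `|x| < 1 ->
  (1 - x) * binom_sum (p + 1) x = binom_sum p x.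
Proof.
move=> p0 x1; have p1 : 0 < p + 1 by rewrite addr_gt0.
have cp1 := is_cvg_binom_series p1 x1.
have partial n : pseries (binom_coef p) x n.+1 =
    (1 - x) * pseries (binom_coef (p + 1)) x n.+1
      + x * (binom_coef (p + 1) n * x ^+ n).
  elim: n => [|n IHn]; first by rewrite !pseriesS !pseries0 !binom_coef0; ring.
  rewrite pseriesS IHn [pseries (binom_coef (p + 1)) x n.+2]pseriesS.
  by rewrite binom_coef_pascal [x ^+ n.+1]exprS; ring.
have lim1 : (1 - x) * pseries (binom_coef (p + 1)) x n.+1
    + x * (binom_coef (p + 1) n * x ^+ n) @[n --> \oo]
    --> (1 - x) * binom_sum (p + 1) x + x * 0.
  apply: cvgD; apply: cvgM; try exact: cvg_cst.
    by rewrite (cvg_shiftS (pseries _ x)).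
  exact: cvg_series_cvg_0 cp1.
apply/esym/cvg_lim => //; rewrite mulr0 addr0 in lim1.
rewrite -cvg_shiftS; apply: cvg_trans lim1; apply: near_eq_cvg.
by apply: nearW => n /=; rewrite partial.
Qed.

(** The sum f_p satisfies f_p' = p f_(p+1) and (1 - x) f_(p+1) = f_p, so
    f_p(x) (1 - x)^p has derivative zero; its value at 0 is 1. *)
Lemma binom_series_cvg (R : realType) (p x : R) : 0 < p -> `|x| < 1 ->
  pseries (binom_coef p) x n @[n --> \oo] --> (1 - x) `^ (- p).
Proof.
move=> p0 x1.
pose g y := binom_sum p y * (1 - y) `^ p.
have dg (y : R) : `|y| < 1 -> is_derive y (1 : R) g 0.
  move=> y1; have y1' : 0 < 1 - y by move: y1; rewrite ltr_norml; lra.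
  have dpow : is_derive y (1 : R) (fun y => (1 - y) `^ p)
      (- (p * (1 - y) `^ (p - 1))).
    have -> : (fun y => (1 - y) `^ p) = (fun y => (1 + (- 1) * y) `^ p).
      by apply/funext => z; rewrite mulN1r.
    have h : is_derive (1 + (-1) * y) 1 (@powR R ^~ p) (p * (1 - y) `^ (p - 1)).
      by rewrite mulN1r; exact: is_derive1_powR.
    by have := is_derive_affine_comp h; rewrite mulN1r; exact.
  apply: is_derive_eq (is_deriveM (is_derive_binom_sum p0 y1) dpow) _.
  rewrite -(binom_sum_pascal p0 y1) /GRing.scale/= -(mulr_powRB1 (ltW y1') p0).
  ring.
have g_cst a b : a <= b -> `|a| < 1 -> `|b| < 1 -> g a = g b.
  move=> ab a1 b1; have I z : z \in `[a, b] -> `|z| < 1.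
    by move: a1 b1; rewrite !ltr_norml in_itv/= => ? ? ?; lra.
  have [||z zab] := @MVT_segment _ g (cst 0) a b ab.
  - by move=> z zab; apply: dg; apply: I; exact: subset_itv_oo_cc zab.
  - by apply: derivable_within_continuous => z /I/dg[].
  - by rewrite mul0r => /eqP; rewrite subr_eq0 => /eqP.
have g0 : g 0 = 1.
  rewrite /g subr0 powR1 mulr1 -(binom_coef0 p).
  by apply/cvg_lim => //; exact: cvg_pseries_at0.
have gx : g x = 1.
  rewrite -g0; have [x0|/ltW x0] := leP x 0.
    by rewrite (g_cst x 0)// normr0.
  by rewrite (g_cst 0 x)// normr0.
have x1' : 0 < 1 - x by move: x1; rewrite ltr_norml; lra.
have -> : (1 - x) `^ (- p) = binom_sum p x.
  rewrite powRN; apply: (mulIf (lt0r_neq0 (powR_gt0 p x1'))).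
  by rewrite mulVf ?lt0r_neq0 ?powR_gt0// -/(g x) gx.
exact: is_cvg_binom_series.
Qed.

(** * Real analytic functions on ]-oo, 1[ *)

(** The terms of the series at d = r / 2 are bounded by some C, which bounds
    the tail of the series at h <= d / 2 by 2 C h / d; letting h tend to 0
    shows that the constant term is as small as desired. *)
Lemma pseries_const_term_eq0 (R : realType) (u : nat -> R) (r : R) : 0 < r ->
  (forall h, 0 < h < r -> pseries u h n @[n --> \oo] --> (0 : R)) -> u 0%N = 0.
Proof.
move=> r0 u0; apply/eqP; rewrite -normr_le0; apply/ler_addgt0Pl => e e0.
pose d := r / 2.
have d0 : 0 < d by rewrite divr_gt0.
have dr : d < r by rewrite /d; lra.
have [C C0 uC] := pseries_bounded (u0 d (introT andP (conj d0 dr))).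
have M0 : 0 < 2 * C / d by rewrite !mulr_gt0 ?invr_gt0.
pose h := Num.min (d / 2) (e / (2 * C / d)).
have h0 : 0 < h by rewrite lt_min !divr_gt0 ?mulr_gt0.
have hd : h <= d / 2 by rewrite ge_min lexx.
have hr : h < r by rewrite (le_lt_trans hd)//; lra.
have tail_le n :
    `|pseries (fun k => u k.+1) h n| <= 2 * C / d * (1 - 2^-1 ^+ n).
  elim: n => [|n IHn]; first by rewrite pseries0 normr0 expr0 subrr mulr0.
  rewrite pseriesS (le_trans (ler_normD _ _))//.
  have step : `|u n.+1 * h ^+ n| <= C / d * 2^-1 ^+ n.
    rewrite normrM (ger0_norm (exprn_ge0 _ (ltW h0))).
    have hn : h ^+ n <= d ^+ n * 2^-1 ^+ n.
      by rewrite -exprMn lerXn2r// nnegrE ltW ?divr_gt0.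
    rewrite (le_trans (ler_wpM2l (normr_ge0 _) hn))// mulrA.
    rewrite ler_wpM2r ?exprn_ge0 ?invr_ge0// ler_pdivlMr//.
    have := uC n.+1.
    by rewrite normrM normrX (gtr0_norm d0) exprSr mulrA.
  rewrite (le_trans (lerD IHn step))// exprS le_eqVlt; apply/orP; left.
  by apply/eqP; field; rewrite gt_eqF.
have key : `|u 0%N| <= h * (2 * C / d).
  have lim0 : pseries u h n.+1 - u 0%N @[n --> \oo] --> - u 0%N.
    rewrite -[X in _ --> X]add0r; apply: cvgB; last exact: cvg_cst.
    by rewrite (cvg_shiftS (pseries u h)); apply: u0; rewrite h0.
  rewrite -normrN -(cvg_lim _ (cvg_norm lim0))//.
  apply: limr_le; first by apply: cvgP (cvg_norm lim0).
  apply: nearW => n; rewrite pseries_tailE addrC addKr normrM (gtr0_norm h0).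
  rewrite ler_wpM2l ?(ltW h0)// (le_trans (tail_le n))//.
  by apply: ler_piMr; [exact: ltW|rewrite gerBl exprn_ge0 ?invr_ge0].
rewrite addr0 (le_trans key)// -ler_pdivlMr//.
by rewrite ge_min lexx orbT.
Qed.

Lemma pseries_coef_eq0 (R : realType) (u : nat -> R) (r : R) : 0 < r ->
  (forall h, 0 < h < r -> pseries u h n @[n --> \oo] --> (0 : R)) ->
  forall n, u n = 0.
Proof.
move=> r0 u0 n; elim: n u u0 => [|n IHn] u u0.
  exact: pseries_const_term_eq0 r0 u0.
apply: (IHn (fun k => u k.+1)) => h hr.
have /andP[h0 _] := hr.
rewrite -[0](mul0r h^-1) -[X in X / h](subrr (u 0%N)).
rewrite [X in (X - _) / _](pseries_const_term_eq0 r0 u0).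
by apply: cvg_pseries_tail; [rewrite gt_eqF|exact: u0].
Qed.

Lemma real_analytic_sub (R : realType) (f g : R -> R) (x : R) :
  real_analytic_at f x -> real_analytic_at g x ->
  real_analytic_at (fun y => f y - g y) x.
Proof.
move=> [u [r [r0 fu]]] [v [s [s0 gv]]].
exists (fun n => u n - v n), (Num.min r s); split; first by rewrite lt_min r0.
move=> h; rewrite lt_min => /andP[hr hs].
apply: (@cvgn_ext _ (fun n => pseries u h n - pseries v h n)).
  elim=> [|n IHn]; first by rewrite !pseries0 subrr.
  by rewrite !pseriesS -IHn; ring.
by apply: cvgB; [exact: fu|exact: gv].
Qed.

(** A power series that vanishes on one side of its centre has zero
    coefficients. The one-sided hypothesis is what is available at the end
    point of an interval on which f vanishes. *)
Lemma real_analytic_eq0_near (R : realType) (f : R -> R) (x e : R) :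
  real_analytic_at f x -> 0 < e -> (forall h, 0 < h < e -> f (x + h) = 0) ->
  exists2 d, 0 < d & forall h, `|h| < d -> f (x + h) = 0.
Proof.
move=> [u [r [r0 fu]]] e0 f0; exists r => // h hr.
have u0 : forall n, u n = 0.
  apply: (@pseries_coef_eq0 _ _ (Num.min r e)); first by rewrite lt_min r0.
  move=> k /andP[k0]; rewrite lt_min => /andP[kr ke].
  by rewrite -(f0 k) ?k0//; apply: fu; rewrite gtr0_norm.
apply/esym/(cvg_unique (@norm_hausdorff _ R^o) _ (fu h hr)).
apply: cvg_near_cst; apply: nearW; elim=> [|n IHn]; first exact: pseries0.
by rewrite pseriesS IHn u0 mul0r addr0.
Qed.

(** If f did not vanish at some x1 < 1, the infimum c of all y <= 0 such that f
    vanishes on [y, 0] would be finite. But f vanishes immediately to the right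
    of c, hence, being analytic, also immediately to the left of c. *)
Lemma real_analytic_identity (R : realType) (f : R -> R) :
  (forall x, x < 1 -> real_analytic_at f x) ->
  (forall x, `|x| < 1 -> f x = 0) -> forall x, x < 1 -> f x = 0.
Proof.
move=> fan f0 x1 x11; apply/eqP; apply/negP => /negP fx1.
have x1N : x1 <= -1.
  rewrite leNgt; apply/negP => x1N; move/negP: fx1; apply; rewrite f0//.
  by rewrite ltr_norml x1N.
pose E := [set y : R | y <= 0 /\ forall z, y <= z <= 0 -> f z = 0].
have Ex1 : lbound E x1.
  move=> y [y0 yf]; rewrite leNgt; apply/negP => yx1.
  by move/negP: fx1; apply; rewrite yf// (ltW yx1)/=; lra.
have Ehalf : E (- 2^-1).
  split; first by lra.
  by move=> z zE; apply: f0; rewrite ltr_norml; lra.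
have hinf : has_inf E by split; [exists (- 2^-1)|exists x1].
pose c := inf E.
have cN : c < 0.
  by rewrite (le_lt_trans (ge_inf _ Ehalf)) ?oppr_lt0//; case: hinf.
have cf z : c < z <= 0 -> f z = 0.
  move=> /andP[cz z0].
  have [y [y0 yf] yz] := inf_lt (proj1 hinf) cz.
  by apply: yf; rewrite (ltW yz).
have [||h hc|d d0 fd] := @real_analytic_eq0_near _ f c (- c).
- by apply: fan; lra.
- by rewrite oppr_gt0.
- by apply: cf; lra.
have Ey : E (c - d / 2).
  split; first by lra.
  move=> z /andP[yz z0]; have [cz|zc] := ltP c z; first by rewrite cf// cz.
  by rewrite -(subrKC c z) fd// ler0_norm; lra.
by have := ge_inf (proj2 hinf) Ey; rewrite -/c; lra.
Qed.

(** The Taylor coefficients v at x of the quotient by the identity function of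
    a function with Taylor coefficients u at x: x v_n + v_(n-1) = u_n. *)
Fixpoint quot_coef (R : realType) (x : R) (u : nat -> R) (n : nat) : R :=
  (u n - if n is k.+1 then quot_coef x u k else 0) / x.

Lemma quot_coef_partial (R : realType) (x h : R) (u : nat -> R) n : x != 0 ->
  (x + h) * pseries (quot_coef x u) h n.+1 =
  pseries u h n.+1 + h * (quot_coef x u n * h ^+ n).
Proof.
move=> x0; elim: n => [|n IHn].
  by rewrite !pseriesS !pseries0 expr0 /=; field.
have stepE : quot_coef x u n.+1 = (u n.+1 - quot_coef x u n) / x by [].
rewrite [pseries (quot_coef x u) h n.+2]pseriesS mulrDr IHn.
by rewrite [pseries u h n.+2]pseriesS stepE !exprS; field.
Qed.

(** The recursion x v_n + v_(n-1) = u_n keeps v_n d^n bounded as soon as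
    d <= |x| / 2, hence the remainder in [quot_coef_partial] tends to 0 for
    |h| < d. *)
Lemma real_analytic_quot (R : realType) (f g : R -> R) (x c : R) : x != 0 ->
  (forall y, y * g y = f y - c) ->
  real_analytic_at f x -> real_analytic_at g x.
Proof.
move=> x0 fg [u' [r [r0 fu']]].
pose u n := u' n - if n is 0%N then c else 0.
have fu h : `|h| < r -> pseries u h n @[n --> \oo] --> (x + h) * g (x + h).
  move=> hr; rewrite fg -(cvg_shiftS (pseries u h)).
  apply: (@cvgn_ext _ (fun n => pseries u' h n.+1 - c)).
    elim=> [|n IHn]; first by rewrite !pseriesS !pseries0 expr0 /u; ring.
    by rewrite pseriesS [RHS]pseriesS -IHn [u n.+1]/u/=; ring.
  apply: cvgB; last exact: cvg_cst.
  by rewrite (cvg_shiftS (pseries u' h)); exact: fu'.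
have ax0 : 0 < `|x| by rewrite normr_gt0.
pose d := Num.min (r / 2) (`|x| / 2).
have d0 : 0 < d by rewrite lt_min !divr_gt0.
have dr : d <= r / 2 by rewrite ge_min lexx.
have dx : d <= `|x| / 2 by rewrite ge_min lexx orbT.
have dltr : `|d| < r by rewrite gtr0_norm//; lra.
have [C C0 uC] := pseries_bounded (fu d dltr).
pose v := quot_coef x u.
(* The bound D = 2 C / |x| is stable under the recursion since d <= |x| / 2:
   (C + d D) / |x| <= C / |x| + D / 2 = D. *)
have vC n : `|v n * d ^+ n| <= 2 * C / `|x|.
  elim: n => [|n IHn].
    have := uC 0%N; rewrite expr0 !mulr1 /v/= subr0 normrM normfV => uC0.
    by rewrite ler_wpM2r ?invr_ge0 ?(ltW ax0)//; lra.
  have -> : v n.+1 * d ^+ n.+1 = (u n.+1 * d ^+ n.+1 - d * (v n * d ^+ n)) / x.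
    by rewrite -[v n.+1]/((u n.+1 - v n) / x) exprS; field.
  rewrite normrM normfV ler_wpM2r ?invr_ge0 ?(ltW ax0)//.
  rewrite (le_trans (ler_normB _ _))// [`|d * _|]normrM (gtr0_norm d0).
  have h1 : d * `|v n * d ^+ n| <= `|x| / 2 * (2 * C / `|x|).
    by apply: ler_pM => //; exact: ltW.
  have h2 : `|x| / 2 * (2 * C / `|x|) = C by field; rewrite gt_eqF.
  have h3 := uC n.+1.
  by lra.
exists v, d; split => // h hd.
have xh0 : x + h != 0.
  apply/eqP => xh; have : `|x| = `|h|.
    by rewrite -[h]opprK normrN -(addrK h x) xh sub0r.
  by lra.
have vlim : v n * h ^+ n @[n --> \oo] --> (0 : R).
  apply: norm_cvg0.
  pose geom n := 2 * C / `|x| * (`|h| / d) ^+ n.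
  apply: (@squeeze_cvgr _ _ _ _ (cst 0) geom).
  - apply: nearW => n; rewrite normr_ge0/= /geom expr_div_n.
    have := ler_wpM2r (exprn_ge0 n (divr_ge0 (normr_ge0 h) (ltW d0))) (vC n).
    rewrite expr_div_n; apply: le_trans; rewrite !normrM !normrX (gtr0_norm d0).
    rewrite le_eqVlt; apply/orP; left; apply/eqP; field.
    by rewrite expf_neq0// gt_eqF.
  - exact: cvg_cst.
  - rewrite /geom -[X in _ --> X](mulr0 (2 * C / `|x|)).
    apply: cvgM; first exact: cvg_cst.
    apply: cvg_expr; rewrite ger0_norm ?divr_ge0 ?(ltW d0)//.
    by rewrite ltr_pdivrMr// mul1r.
rewrite -(cvg_shiftS (pseries v h)).
apply: (@cvgn_ext _
  (fun n => (pseries u h n.+1 + h * (v n * h ^+ n)) / (x + h))).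
  by move=> n; rewrite -quot_coef_partial//; field.
have hr : `|h| < r by lra.
rewrite -[X in _ --> X](mulKf xh0) mulrC.
apply: cvgM; last exact: cvg_cst.
rewrite -[X in _ --> X]addr0 -[X in _ --> _ + X](mulr0 h).
apply: cvgD; first by rewrite (cvg_shiftS (pseries u h)); exact: fu.
by apply: cvgM => //; exact: cvg_cst.
Qed.

(** For u = [gauss_coef a b c] this unfolds to [is_gauss_2F1]. *)
Definition analytic_extension (R : realType) (u : nat -> R) (F : R -> R) :=
  (forall x : R, `|x| < 1 -> pseries u x n @[n --> \oo] --> F x) /\
  (forall x : R, x < 1 -> real_analytic_at F x).

Lemma analytic_extension_unique (R : realType) (u : nat -> R) (F G : R -> R) :
  analytic_extension u F -> analytic_extension u G ->
  forall x, x < 1 -> F x = G x.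
Proof.
move=> [uF Fan] [uG Gan] x x1; apply/eqP; rewrite -subr_eq0; apply/eqP.
apply: (@real_analytic_identity _ (fun y => F y - G y)) x1.
  by move=> y y1; apply: real_analytic_sub; [exact: Fan|exact: Gan].
move=> y y1; apply/eqP; rewrite subr_eq0; apply/eqP.
exact: (cvg_unique (@norm_hausdorff _ R^o) (uF y y1) (uG y y1)).
Qed.

Lemma hyp2F1_unique (R : realType) (a b c x : R) (F : R -> R) : x < 1 ->
  analytic_extension (gauss_coef a b c) F -> hyp2F1 a b c x = F x.
Proof.
move=> x1 aF; rewrite /hyp2F1; case: xgetP => [y _ [G aG <-]|/(_ (F x))].
  exact: analytic_extension_unique aG aF _ x1.
by case; exists F.
Qed.

Lemma analytic_extension_scale (R : realType) (k : R) (u : nat -> R)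
    (F : R -> R) : analytic_extension u F ->
  analytic_extension (fun n => k * u n) (fun x => k * F x).
Proof.
move=> [uF Fan]; split=> [x x1|x x1].
  apply: (cvgn_ext (fun n => esym (pseriesZ k u x n))).
  by apply: cvgM; [exact: cvg_cst|exact: uF].
have [v [r [r0 vF]]] := Fan x x1; exists (fun n => k * v n), r; split=> // h hr.
apply: (cvgn_ext (fun n => esym (pseriesZ k v h n))).
by apply: cvgM; [exact: cvg_cst|exact: vF].
Qed.

(** At 0 the shifted series itself witnesses analyticity; elsewhere G is the
    quotient of an analytic function by x. *)
Lemma analytic_extension_tail (R : realType) (u : nat -> R) (F G : R -> R) :
  analytic_extension u F -> (forall x, x * G x = F x - u 0%N) -> G 0 = u 1%N ->
  analytic_extension (fun n => u n.+1) G.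
Proof.
move=> [uF Fan] FG G0.
have tailG x : `|x| < 1 -> pseries (fun n => u n.+1) x n @[n --> \oo] --> G x.
  move=> x1; have [->|x0] := eqVneq x 0.
    by rewrite G0; exact: cvg_pseries_at0.
  rewrite -[G x](mulKf x0) FG mulrC; apply: cvg_pseries_tail => //; exact: uF.
split=> // x x1; have [->|x0] := eqVneq x 0.
  by exists (fun n => u n.+1), 1; split=> // h h1; rewrite add0r; exact: tailG.
exact: real_analytic_quot x0 FG (Fan x x1).
Qed.

(** At x < 1 expand (1 - x - h)^(-q) = (1 - x)^(-q) (1 - h / (1 - x))^(-q); the
    radius of convergence is 1 - x. *)
Lemma analytic_extension_binom (R : realType) (q : R) : 0 < q ->
  analytic_extension (binom_coef q) (fun x => (1 - x) `^ (- q)).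
Proof.
move=> q0; split=> [x x1|x x1]; first exact: binom_series_cvg.
have x10 : 0 < 1 - x by rewrite subr_gt0.
exists (fun n => (1 - x) `^ (- q) * (binom_coef q n / (1 - x) ^+ n)), (1 - x).
split=> // h hx.
have hx1 : `|h / (1 - x)| < 1.
  by rewrite normrM normfV (gtr0_norm x10) ltr_pdivrMr// mul1r.
pose v n := binom_coef q n / (1 - x) ^+ n.
apply: (cvgn_ext (fun n => esym (pseriesZ ((1 - x) `^ (- q)) v h n))).
have -> : (1 - (x + h)) `^ (- q) =
    (1 - x) `^ (- q) * (1 - h / (1 - x)) `^ (- q).
  have hx1' : 0 <= 1 - h / (1 - x).
    by rewrite subr_ge0 (le_trans (ler_norm _))// ltW.
  rewrite -powRM ?(ltW x10)//.
  by congr (_ `^ _); field; rewrite gt_eqF.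
have rescale n : pseries (binom_coef q) (h / (1 - x)) n = pseries v h n.
  elim: n => [|n IHn]; first by rewrite !pseries0.
  by rewrite !pseriesS IHn /v expr_div_n mulrA mulrAC.
apply: cvgM; first exact: cvg_cst.
exact: cvgn_ext rescale (binom_series_cvg q0 hx1).
Qed.

(** The value at 0 is the limit of the quotient at 0. *)
Definition binom_tail (R : realType) (q : R) (k : nat) (x : R) : R :=
  if x == 0 then binom_coef q k
  else ((1 - x) `^ (- q) - pseries (binom_coef q) x k) / x ^+ k.

Lemma analytic_extension_binom_tail (R : realType) (q : R) (k : nat) : 0 < q ->
  analytic_extension (fun n => binom_coef q (k + n)) (binom_tail q k).
Proof.
move=> q0; elim: k => [|k IHk].
  rewrite (_ : binom_tail q 0 = fun x => (1 - x) `^ (- q)).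
    exact: analytic_extension_binom.
  apply/funext => x; rewrite /binom_tail; case: eqVneq => [->|_].
    by rewrite subr0 powR1 binom_coef0.
  by rewrite pseries0 expr0 divr1 subr0.
rewrite (_ : (fun n => _) = (fun n => (fun i => binom_coef q (k + i)) n.+1));
  last first.
  by apply/funext => n; rewrite addSnnS.
apply: analytic_extension_tail IHk _ _ => [x|]; last first.
  by rewrite /binom_tail eqxx addn1.
rewrite addn0 /binom_tail; case: eqVneq => [->|x0].
  by rewrite mul0r subrr.
by rewrite pseriesS exprS; field; rewrite x0 expf_neq0.
Qed.

Lemma gauss_coef_binom (R : realType) (q : R) (k n : nat) : 0 < q ->
  gauss_coef (q + k%:R) 1 (1 + k%:R) n =
  k`!%:R / pochhammer q k * binom_coef q (k + n).
Proof.
move=> q0; rewrite /gauss_coef /binom_coef pochhammerD.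
rewrite -(pochhammer_fact R (k + n)) pochhammerD !pochhammer_fact.
have h1 : n`!%:R != 0 :> R by rewrite pnatr_eq0 -lt0n fact_gt0.
have h2 : k`!%:R != 0 :> R by rewrite pnatr_eq0 -lt0n fact_gt0.
have h3 : pochhammer (1 + k%:R : R) n != 0.
  by rewrite gt_eqF// pochhammer_gt0// ltr_wpDr.
have h4 : pochhammer q k != 0 by rewrite gt_eqF// pochhammer_gt0.
by field; rewrite h1 h2 h3 h4.
Qed.

(** The parameters a and c are tied to q and k by equations because in an
    instance they are numerals, not syntactically sums. *)
Lemma hyp2F1_closed_form (R : realType) (a c q x : R) (k : nat) :
  a = q + k%:R -> c = 1 + k%:R -> 0 < q -> x < 1 -> x != 0 ->
  hyp2F1 a 1 c x =
  k`!%:R / pochhammer q k *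
  (((1 - x) `^ (- q) - pseries (binom_coef q) x k) / x ^+ k).
Proof.
move=> -> -> q0 x1 x0.
rewrite (@hyp2F1_unique _ _ _ _ _
  (fun y => k`!%:R / pochhammer q k * binom_tail q k y))//.
  by rewrite /binom_tail (negbTE x0).
rewrite (_ : gauss_coef _ _ _ =
    fun n => k`!%:R / pochhammer q k * binom_coef q (k + n)).
  exact/analytic_extension_scale/analytic_extension_binom_tail.
by apply/funext => n; exact: gauss_coef_binom.
Qed.

(** * Integration of a derivative over a segment *)

Lemma is_derive_continuous (R : realType) (f : R -> R) (x df : R) :
  is_derive x 1 f df -> {for x, continuous f}.
Proof.
by move=> [dfx _]; apply/differentiable_continuous/derivable1_diffP.
Qed.

Lemma integral_FTC (R : realType) (f F : R -> R) (a b : R) : a <= b ->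
  (forall x, a <= x <= b -> is_derive x 1 F (f x)) ->
  (forall x, a <= x <= b -> {for x, continuous f}) ->
  (\int[@lebesgue_measure R]_(x in `[a, b]) (f x)%:E = (F b - F a)%:E)%E.
Proof.
rewrite le_eqVlt => /predU1P[->|ab] dF cf.
  by rewrite set_itv1 integral_set1 subrr.
have cF x : a <= x <= b -> {for x, continuous F}.
  by move=> /dF; exact: is_derive_continuous.
rewrite (continuous_FTC2 ab (F := F)).
- by rewrite EFinB.
- apply/continuous_within_itvP => //; split=> [x xab||].
  + by apply: cf; rewrite !ltW ?(itvP xab).
  + by apply: cvg_at_right_filter; apply: cf; rewrite lexx ltW.
  + by apply: cvg_at_left_filter; apply: cf; rewrite lexx ltW.
- split=> [x xab||].
  + by have [] := dF x _; rewrite ?ltW ?(itvP xab).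
  + by apply: cvg_at_right_filter; apply: cF; rewrite lexx ltW.
  + by apply: cvg_at_left_filter; apply: cF; rewrite lexx ltW.
- move=> x xab; rewrite derive1E.
  by have [] := dF x _; rewrite ?ltW ?(itvP xab).
Qed.

(** * The Gamma function *)

Definition gamma_integrand (R : realType) (z u : R) : R :=
  u `^ (z - 1) * expR (- u).

Lemma gamma_integrand_ge0 (R : realType) (z u : R) : 0 <= gamma_integrand z u.
Proof. by rewrite mulr_ge0 ?powR_ge0 ?expR_ge0. Qed.

Lemma measurable_gamma_integrand (R : realType) (z : R) (D : set R) :
  measurable_fun D (gamma_integrand z).
Proof.
apply: measurable_funS (measurableT) _ _ => //.
apply: measurable_funM; first exact: measurable_powR.
by apply: measurableT_comp; [exact: measurable_expR|exact: oppr_measurable].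
Qed.

Lemma is_derive_expRN (R : realType) (u : R) :
  is_derive u 1 (fun u : R => expR (- u)) (- expR (- u)).
Proof. by rewrite -mulrN1; apply: is_derive1_comp. Qed.

(** This is the integration by parts behind the functional equation. *)
Lemma is_derive_gamma_integrand (R : realType) (z u : R) : 0 < u ->
  is_derive u 1 (gamma_integrand (z + 1))
    (z * gamma_integrand z u - gamma_integrand (z + 1) u).
Proof.
move=> u0; rewrite /gamma_integrand.
have dp : is_derive u 1 (@powR R ^~ (z + 1 - 1)) (z * u `^ (z - 1)).
  rewrite addrK; exact: is_derive1_powR.
apply: is_derive_eq (is_deriveM dp (is_derive_expRN u)) _.
by rewrite /GRing.scale/= addrK; ring.
Qed.

Lemma gamma_integrand_cvgy (R : realType) (z : R) :
  gamma_integrand z n.+1%:R @[n --> \oo] --> (0 : R).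
Proof.
pose k := (Num.truncn `|z - 1|).+1.
have zk : z - 1 <= k%:R.
  by rewrite (le_trans (ler_norm _))// ltW// truncnS_gt.
apply: (@squeeze_cvgr _ _ _ _ (cst 0) (fun n => k.+1`!%:R * n.+1%:R^-1)).
- apply: nearW => n; rewrite gamma_integrand_ge0/= /gamma_integrand.
  have n1 : 1 <= n.+1%:R :> R by rewrite ler1n.
  have n0 : 0 < n.+1%:R :> R by [].
  rewrite expRN ler_pdivrMr ?expR_gt0//.
  rewrite (le_trans (ler_powR n1 zk))// powR_mulrn ?(ltW n0)//.
  have expk : n.+1%:R ^+ k.+1 / k.+1`!%:R <= expR n.+1%:R :> R.
    by rewrite (le_trans _ (expR_ge1Dxn k (ltW n0)))// lerDr.
  have -> : n.+1%:R ^+ k =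
      k.+1`!%:R / n.+1%:R * (n.+1%:R ^+ k.+1 / k.+1`!%:R) :> R.
    have : k.+1`!%:R != 0 :> R by rewrite pnatr_eq0 -lt0n fact_gt0.
    move: (k.+1`!%:R) (lt0r_neq0 n0) => f; move: (n.+1%:R) => y y0 f0.
    by rewrite exprS; field; rewrite y0 f0.
  by apply: ler_wpM2l; [exact: divr_ge0|exact: expk].
- exact: cvg_cst.
- rewrite -[X in _ --> X](mulr0 k.+1`!%:R); apply: cvgM; first exact: cvg_cst.
  exact: cvg_harmonic.
Qed.

Lemma gamma_integrand_cvg0 (R : realType) (z : R) : 0 < z ->
  gamma_integrand (z + 1) n.+1%:R^-1 @[n --> \oo] --> (0 : R).
Proof.
move=> z0; rewrite /gamma_integrand addrK.
apply: (@squeeze_cvgr _ _ _ _ (cst 0) (fun n => n.+1%:R^-1 `^ z)).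
- apply: nearW => n; rewrite mulr_ge0 ?powR_ge0 ?expR_ge0//=.
  by rewrite ler_piMr ?powR_ge0// expR_le1 oppr_le0 invr_ge0.
- exact: cvg_cst.
- have /cvg_at_rightP := powR_cvg0 z0; apply; split; last exact: cvg_harmonic.
  by move=> n; rewrite invr_gt0.
Qed.

(** The windows stay away from 0 because the integrand is unbounded there when
    z < 1. *)
Definition gamma_window (R : realType) (n : nat) : set R :=
  `[n.+1%:R^-1, n.+1%:R]%classic.

Lemma bigcup_gamma_window (R : realType) :
  \bigcup_n (@gamma_window R n) = `]0, +oo[%classic.
Proof.
apply/seteqP; split => [u [n _]|u].
  rewrite /gamma_window/= !in_itv/= andbT => /andP[un _].
  by apply: lt_le_trans un; rewrite invr_gt0.
rewrite /= in_itv/= andbT => u0.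
pose n := Num.truncn (Num.max u u^-1).
have un : Num.max u u^-1 < n.+1%:R by apply: truncnS_gt.
exists n => //; rewrite /gamma_window/= in_itv/=.
have : u < n.+1%:R by rewrite (le_lt_trans _ un)// le_max lexx.
have : u^-1 < n.+1%:R by rewrite (le_lt_trans _ un)// le_max lexx orbT.
move=> h1 /ltW ->; rewrite andbT -[leRHS]invrK lef_pV2 ?posrE ?invr_gt0//.
exact: ltW.
Qed.

Lemma cvg_gamma_window (R : realType) (z : R) :
  (\int[@lebesgue_measure R]_(u in gamma_window n) (gamma_integrand z u)%:E)%E
    @[n --> \oo] -->
  (\int[@lebesgue_measure R]_(u in `]0%R, +oo[) (gamma_integrand z u)%:E)%E.
Proof.
rewrite -bigcup_gamma_window; apply: ge0_nondecreasing_set_cvg_integral => //.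
- move=> n p np; rewrite subsetEset; apply: subset_itv; rewrite bnd_simp.
    by rewrite lef_pV2 ?posrE// ler_nat.
  by rewrite ler_nat.
- by move=> n; exact: measurable_itv.
- by move=> n; apply/measurable_EFinP; exact: measurable_gamma_integrand.
- by move=> n u _; rewrite lee_fin gamma_integrand_ge0.
Qed.

Lemma integrable_gamma_window (R : realType) (z : R) (n : nat) :
  (@lebesgue_measure R).-integrable (@gamma_window R n)
    (EFin \o gamma_integrand z).
Proof.
apply: continuous_compact_integrable; first exact: segment_compact.
apply: continuous_in_subspaceT => u.
rewrite inE /gamma_window/= in_itv/= => /andP[un _].
have u0 : 0 < u by apply: lt_le_trans un; rewrite invr_gt0.
rewrite -(subrK 1 z); apply: is_derive_continuous.
exact: is_derive_gamma_integrand.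
Qed.

Lemma fine_mul_gt0 (R : realType) (r : R) (x : \bar R) : 0 < r ->
  fine (r%:E * x)%E = r * fine x.
Proof.
move=> r0; case: x => [x| |] //=.
  by rewrite gt0_muley ?lte_fin// mulr0.
by rewrite gt0_muleNy ?lte_fin// mulr0.
Qed.

(** Integrate [is_derive_gamma_integrand] over [gamma_window n] and let n tend
    to infinity. The passage to the limit takes place in the extended reals,
    where the identity between the integrals makes sense whether or not they
    are finite, and [fine] preserves it. *)
Lemma Gamma_rec (R : realType) (z : R) : 0 < z -> Gamma (z + 1) = z * Gamma z.
Proof.
move=> z0.
pose mu := @lebesgue_measure R.
pose I w := (\int[mu]_(u in `]0%R, +oo[) (gamma_integrand w u)%:E)%E.
suff IE : (I (z + 1)%R = z%:E * I z)%E.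
  by rewrite -[LHS]/(fine (I (z + 1))) IE fine_mul_gt0.
pose J w n := (\int[mu]_(u in gamma_window n) (gamma_integrand w u)%:E)%E.
pose B n :=
  gamma_integrand (z + 1) n.+1%:R^-1 - gamma_integrand (z + 1) n.+1%:R.
have JE n : (J (z + 1)%R n = (B n)%:E + z%:E * J z n)%E.
  pose RJ w := \int[mu]_(u in gamma_window n) gamma_integrand w u.
  have JRJ w : J w n = (RJ w)%:E.
    rewrite /RJ /Rintegral fineK//; apply: integrable_fin_num => //.
      exact: measurable_itv.
    exact: integrable_gamma_window.
  have win : n.+1%:R^-1 <= n.+1%:R :> R.
    by rewrite (@le_trans _ _ 1)// ?ler1n// invf_le1// ler1n.
  have pos u : n.+1%:R^-1 <= u <= n.+1%:R -> 0 < u :> R.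
    by move=> /andP[un _]; apply: lt_le_trans un; rewrite invr_gt0.
  have FTC : \int[@lebesgue_measure R]_(u in gamma_window n)
      (z * gamma_integrand z u - gamma_integrand (z + 1) u) = - B n.
    have df (u : R) : n.+1%:R^-1 <= u <= n.+1%:R ->
        is_derive u 1 (gamma_integrand (z + 1))
          (z * gamma_integrand z u - gamma_integrand (z + 1) u).
      by move=> /pos u0; exact: is_derive_gamma_integrand.
    rewrite /Rintegral (integral_FTC win df); first by rewrite /B opprB.
    move=> u /pos u0; apply: cvgB.
      apply: cvgM; first exact: cvg_cst.
      rewrite -(subrK 1 z); apply: is_derive_continuous.
      exact: is_derive_gamma_integrand.
    by apply: is_derive_continuous; exact: is_derive_gamma_integrand.
  have mwin : measurable (gamma_window n : set (measurableTypeR R)).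
    exact: measurable_itv.
  have iwin (w : R) := integrable_gamma_window w n.
  have iz : (@lebesgue_measure R).-integrable (@gamma_window R n)
      (EFin \o (fun u => z * gamma_integrand z u)).
    by have := integrableZl mwin z (iwin z); apply: eq_integrable.
  rewrite RintegralB ?RintegralZl// in FTC.
  rewrite !JRJ -EFinM -EFinD; congr _%:E.
  by rewrite -[B n]opprK -FTC opprB subrK.
have B0 : (B n)%:E @[n --> \oo] --> 0%E.
  apply: cvg_EFin; first exact: nearW.
  rewrite -[0](subrr 0); apply: cvgB; first exact: gamma_integrand_cvg0.
  exact: gamma_integrand_cvgy.
have limJ : ((B n)%:E + z%:E * J z n)%E @[n --> \oo] --> (0 + z%:E * I z)%E.
  by apply: cvgeD => //; apply: cvgeZl => //; exact: cvg_gamma_window.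
rewrite add0e -(funext JE) in limJ.
exact: (cvg_unique (@ereal_hausdorff R) (@cvg_gamma_window R (z + 1)) limJ).
Qed.

Lemma Gamma1 (R : realType) : Gamma 1 = 1 :> R.
Proof.
have cexpN : continuous (fun u : R => expR (- u)).
  move=> u; apply: (@continuous_comp _ _ _ -%R expR).
    exact: opp_continuous.
  exact: continuous_expR.
have GammaE : Gamma 1 =
    fine (\int[@lebesgue_measure R]_(u in `[0%R, +oo[) (expR (- u))%:E)%E.
  rewrite -integral_itv_obnd_cbnd; last first.
    apply/measurable_EFinP; apply: measurable_funTS.
    exact: continuous_measurable_fun.
  by congr fine; apply: eq_integral => u _; rewrite subrr powRr0 mul1r.
rewrite GammaE (@ge0_continuous_FTC2y _ _ (fun u => - expR (- u)) _ 0).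
- by rewrite oppr0 expR0 EFinN oppeK add0e.
- by move=> u _; exact: expR_ge0.
- exact: continuous_subspaceT.
- rewrite -[X in _ --> X]oppr0; apply: cvgN; exact: cvgr_expR.
- by move=> u _; exact: ex_derive.
- by apply: cvg_at_right_filter; apply: cvgN; exact: cexpN.
- move=> u _; rewrite derive1E.
  by have [_ ->] := is_deriveN (is_derive_expRN u); rewrite opprK.
Qed.

Lemma Gamma_fact (R : realType) n : Gamma n.+1%:R = n`!%:R :> R.
Proof.
elim: n => [|n IHn]; first by rewrite Gamma1.
by rewrite -natr1 Gamma_rec ?ltr0n// IHn factS natrM.
Qed.

Lemma Gamma_natr (R : realType) (z : R) (n : nat) : z = n.+1%:R ->
  Gamma z = n`!%:R.
Proof. by move=> ->; exact: Gamma_fact. Qed.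

Lemma Gamma_shift (R : realType) (q : R) (n : nat) : 0 < q ->
  Gamma (q + n%:R) = pochhammer q n * Gamma q.
Proof.
move=> q0; elim: n => [|n IHn]; first by rewrite addr0 pochhammer0 mul1r.
have qn0 : 0 < q + n%:R by rewrite ltr_wpDr.
rewrite (_ : q + n.+1%:R = q + n%:R + 1); last by rewrite -natr1 addrA.
by rewrite (Gamma_rec qn0) IHn pochhammerS mulrAC [RHS]mulrC.
Qed.

(** * Integration over the triangle *)

Lemma measurable_simplex2 (R : realType) :
  measurable (@simplex2 R : set (measurableTypeR R * measurableTypeR R)).
Proof.
pose T := (measurableTypeR R * measurableTypeR R)%type.
have mge0 : measurable [set u : measurableTypeR R | 0 <= u].
  by rewrite -set_itv_c_infty; exact: measurable_itv.
have m1 : measurable_fun [set: T] (fun z : T => z.1 : R).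
  exact: measurable_fst.
have m2 : measurable_fun [set: T] (fun z : T => z.2 : R).
  exact: measurable_snd.
have m3 : measurable_fun [set: T] (fun z : T => 1 - (z.1 + z.2) : R).
  by apply: measurable_funB => //; exact: measurable_funD.
rewrite (_ : @simplex2 R =
  ((fun z : T => z.1) @^-1` [set u | 0 <= u] `&`
   (fun z : T => z.2) @^-1` [set u | 0 <= u]) `&`
   (fun z : T => 1 - (z.1 + z.2)) @^-1` [set u : R | 0 <= u]).
  apply: measurableI; first apply: measurableI.
  - by rewrite -[X in measurable X]setTI; exact: m1.
  - by rewrite -[X in measurable X]setTI; exact: m2.
  - by rewrite -[X in measurable X]setTI; exact: m3.
apply/seteqP; split=> [z [? ? ?]|z [[/= ? ?] ?]]; split => //=.
  by rewrite subr_ge0.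
by rewrite -subr_ge0.
Qed.

(** Tonelli followed by the fundamental theorem of calculus in each variable.
    The integrand f and its nicer form h only have to agree on the triangle:
    with f built from real powers, f need not be continuous across the
    boundary, whereas h is. *)
Lemma integral_simplex2 (R : realType) (f : R * R -> R) (h H : R -> R -> R)
    (Phi : R -> R) :
  measurable_fun [set: measurableTypeR R * measurableTypeR R] f ->
  (forall z, 0 <= f z) ->
  (forall p q, simplex2 (p, q) -> f (p, q) = h p q) ->
  (forall p q, simplex2 (p, q) -> is_derive q 1 (H p) (h p q)) ->
  (forall p q, simplex2 (p, q) -> {for q, continuous (h p)}) ->
  (forall p : R, 0 <= p <= 1 -> is_derive p 1 Phi (H p (1 - p) - H p 0)) ->
  (forall p : R, 0 <= p <= 1 ->
    {for p, continuous (fun p => H p (1 - p) - H p 0)}) ->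
  \int[(@lebesgue_measure R \x @lebesgue_measure R)%E]_(z in @simplex2 R) f z
  = Phi 1 - Phi 0.
Proof.
move=> mf f0 fh dH ch dPhi cG.
rewrite /Rintegral integral_mkcond fubini_tonelli1; last 2 first.
- apply/(measurable_restrictT _ (@measurable_simplex2 R)).
  by apply/measurable_EFinP; apply: measurable_funTS.
- by move=> z; apply: erestrict_ge0 => {}z _; rewrite lee_fin.
pose G p := H p (1 - p) - H p 0.
have inner p : fubini_F (@lebesgue_measure R) ((EFin \o f) \_ @simplex2 R) p =
    ((EFin \o G) \_ `[0%R, 1%R]%classic) p.
  rewrite /fubini_F; have [p01|p01] := boolP (0 <= p <= 1); last first.
    rewrite [RHS]patchE memNset; last by rewrite /= in_itv/=; exact/negP.
    apply: integral0_eq => q _; rewrite patchE memNset// => -[/= p0 q0 pq].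
    by move/negP: p01; apply; rewrite p0/=; lra.
  rewrite [RHS]patchE mem_set; last by rewrite /= in_itv.
  have [p0 p1] := andP p01.
  have Sq q : (0 <= q <= 1 - p) = ((p, q) \in @simplex2 R).
    apply/idP/idP => [/andP[q0 qp]|]; first by rewrite inE; split => //=; lra.
    by rewrite inE => -[/= _ q0 pq]; rewrite q0; lra.
  transitivity
      (\int[@lebesgue_measure R]_(q in `[0%R, (1 - p)%R]) (h p q)%:E)%E.
    rewrite [RHS]integral_mkcond; apply: eq_integral => q _.
    rewrite !patchE -Sq [q \in _](_ : _ = (0 <= q <= 1 - p)); last first.
      by apply/idP/idP; rewrite inE/= in_itv/=.
    by case: ifPn => //; rewrite Sq inE => pqS; rewrite /= fh.
  have dHp q : 0 <= q <= 1 - p -> is_derive q 1 (H p) (h p q).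
    by rewrite Sq inE; exact: dH.
  rewrite (integral_FTC _ dHp) ?subr_ge0//.
  by move=> q; rewrite Sq inE; exact: ch.
transitivity
    (fine (\int[@lebesgue_measure R]_p ((EFin \o G) \_ `[0%R, 1%R]) p)).
  by congr fine; apply: eq_integral => p _; exact: inner.
by rewrite -integral_mkcond (integral_FTC ler01 dPhi).
Qed.

Definition appell_integrand (R : realType) (a b b' g x y : R) (z : R * R) : R :=
  z.1 `^ (b - 1) * z.2 `^ (b' - 1) * (1 - z.1 - z.2) `^ (g - b - b' - 1) *
  (1 - x * z.1 - y * z.2) `^ (- a).

Lemma appell_integrand_ge0 (R : realType) (a b b' g x y : R) z :
  0 <= appell_integrand a b b' g x y z.
Proof. by rewrite !mulr_ge0 ?powR_ge0. Qed.

Lemma measurable_appell_integrand (R : realType) (a b b' g x y : R) :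
  measurable_fun [set: measurableTypeR R * measurableTypeR R]
    (appell_integrand a b b' g x y).
Proof.
pose T := (measurableTypeR R * measurableTypeR R)%type.
have m1 : measurable_fun [set: T] (fun z : T => z.1 : R).
  exact: measurable_fst.
have m2 : measurable_fun [set: T] (fun z : T => z.2 : R).
  exact: measurable_snd.
have mpow (r : R) (f : T -> R) : measurable_fun setT f ->
    measurable_fun setT (fun z => f z `^ r).
  by move=> mf; apply: measurableT_comp (measurable_powR r) mf.
have mZ (r : R) (f : T -> R) : measurable_fun setT f ->
    measurable_fun setT (fun z => r * f z).
  by move=> mf; apply: measurable_funM => //; exact: measurable_cst.
apply: measurable_funM.
  apply: measurable_funM.
    by apply: measurable_funM; [exact: mpow m1|exact: mpow m2].
  apply: mpow; apply: measurable_funB; last exact: m2.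
  by apply: measurable_funB; [exact: measurable_cst|exact: m1].
apply: mpow; apply: measurable_funB; last exact: mZ.
by apply: measurable_funB; [exact: measurable_cst|exact: mZ].
Qed.

(** The form takes the positive values 1, 1 - x and 1 - y at the vertices. *)
Lemma simplex2_affine_gt0 (R : realType) (x y p q : R) : x < 1 -> y < 1 ->
  simplex2 (p, q) -> 0 < 1 - x * p - y * q.
Proof.
move=> x1 y1 [/= p0 q0 pq].
have hx : 0 <= (1 - x) * p by rewrite mulr_ge0// subr_ge0 ltW.
have hy : 0 <= (1 - y) * q by rewrite mulr_ge0// subr_ge0 ltW.
have [pq1|pq1] := ltP (p + q) 1; first by lra.
have [pp|pp] := ltP 0 p.
  have : 0 < (1 - x) * p by rewrite mulr_gt0// subr_gt0.
  by lra.
have : 0 < (1 - y) * q by rewrite mulr_gt0 ?subr_gt0//; lra.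
by lra.
Qed.

Lemma edge_r0_gt0 (R : realType) (x p : R) : x < 1 -> 0 <= p <= 1 ->
  0 < 1 + - x * p.
Proof.
move=> x1 /andP[p0 p1].
have /(simplex2_affine_gt0 x1 x1) : simplex2 (p, 0).
  by split => //=; rewrite addr0.
by rewrite mulr0 subr0 mulNr.
Qed.

Lemma hypotenuse_gt0 (R : realType) (x y p : R) : x < 1 -> y < 1 ->
  0 <= p <= 1 -> 0 < 1 - y + (y - x) * p.
Proof.
move=> x1 y1 /andP[p0 p1].
have -> : 1 - y + (y - x) * p = 1 - x * p - y * (1 - p) by ring.
by apply: simplex2_affine_gt0 => //; split => //=; rewrite ?subr_ge0// subrKC.
Qed.

(** * Primitives of quadratic polynomials times derivatives of a power *)

(** The k-th derivative of u^(-q). *)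
Definition dpowR (R : realType) (q : R) (k : nat) (u : R) : R :=
  (-1) ^+ k * pochhammer q k * u `^ (- (q + k%:R)).

Lemma is_derive_dpowR (R : realType) (q : R) (k : nat) (u : R) : 0 < u ->
  is_derive u 1 (dpowR q k) (dpowR q k.+1 u).
Proof.
move=> u0.
apply: is_derive_eq (is_deriveZ ((-1) ^+ k * pochhammer q k)
  (is_derive1_powR (- (q + k%:R)) u0)) _.
rewrite /dpowR /GRing.scale/= pochhammerS exprS -natr1.
rewrite (_ : - (q + (k%:R + 1)) = - (q + k%:R) - 1); last by ring.
ring.
Qed.

Lemma powRN_dpowR (R : realType) (q u : R) k : 0 < q ->
  u `^ (- (q + k%:R)) = (-1) ^+ k / pochhammer q k * dpowR q k u.
Proof.
move=> q0; rewrite /dpowR.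
have h : pochhammer q k != 0 by rewrite gt_eqF// pochhammer_gt0.
have -> : (-1) ^+ k / pochhammer q k *
  ((-1) ^+ k * pochhammer q k * u `^ (- (q + k%:R))) =
  (-1) ^+ k * (-1) ^+ k * u `^ (- (q + k%:R)) by field.
by rewrite -exprMn mulrNN mulr1 expr1n mul1r.
Qed.

(** All inner and outer integrands and their primitives are linear
    combinations of such terms, so one derivation rule suffices. *)
Definition qterm (R : realType) (q a b c : R) (k : nat) (e s x : R) : R :=
  (a + b * x + c * x ^+ 2) * dpowR q k (e + s * x).

Lemma is_derive_qterm (R : realType) (q a b c : R) (k : nat) (e s x : R) :
  0 < e + s * x ->
  is_derive x 1 (qterm q a b c k e s)
    ((b + 2 * c * x) * dpowR q k (e + s * x)
     + s * (a + b * x + c * x ^+ 2) * dpowR q k.+1 (e + s * x)).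
Proof.
move=> u0.
have dw : is_derive x 1 (fun x : R => a + b * x + c * x ^+ 2) (b + 2 * c * x).
  by apply: is_derive_eq; rewrite /GRing.scale/=; ring.
have dg := is_derive_affine_comp (is_derive_dpowR q k u0).
apply: is_derive_eq (is_deriveM dw dg) _.
by rewrite /GRing.scale/=; ring.
Qed.

Lemma is_derive_lin (R : realType) (k df dg x : R) (f g : R -> R) :
  is_derive x 1 f df -> is_derive x 1 g dg ->
  is_derive x 1 (fun z => k * f z + g z) (k * df + dg).
Proof. by move=> hf hg; exact: is_deriveD (is_deriveZ k hf) hg. Qed.

Lemma is_derive_lin1 (R : realType) (k df x : R) (f : R -> R) :
  is_derive x 1 f df -> is_derive x 1 (fun z => k * f z) (k * df).
Proof. by move=> hf; apply: is_derive_eq (is_deriveZ k hf) _. Qed.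

Lemma simplex_integral_linear (R : realType) (q x y : R) : 0 < q ->
  x < 1 -> y < 1 -> x != 0 -> y != 0 -> x != y ->
  \int[(@lebesgue_measure R \x @lebesgue_measure R)%E]_(z in @simplex2 R)
    appell_integrand (q + 3) 1 1 4 x y z =
  - (pochhammer q 3)^-1 *
   (dpowR q 0 (1 - x)
      * ((x * y ^+ 2)^-1 + (x ^+ 2 * y)^-1 + ((y - x) * y ^+ 2)^-1)
    - dpowR q 0 (1 - y) / ((y - x) * y ^+ 2)
    - dpowR q 0 1 * ((x * y ^+ 2)^-1 + (x ^+ 2 * y)^-1)
    + dpowR q 1 1 / (x * y)).
Proof.
move=> q0 x1 y1 x0 y0 xy.
pose c := - (pochhammer q 3)^-1.
(* H p and Phi are the primitives of h p and of G that integration by parts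
   produces when it is repeated until the polynomial factor is constant. *)
pose h p r := c * qterm q (1 - p) (-1) 0 3 (1 - x * p) (- y) r.
pose H p r := - c / y * qterm q (1 - p) (-1) 0 2 (1 - x * p) (- y) r
   + c / y ^+ 2 * qterm q 1 0 0 1 (1 - x * p) (- y) r.
pose G p := c / y ^+ 2 * qterm q 1 0 0 1 (1 - y) (y - x) p
   + (c / y * qterm q 1 (-1) 0 2 1 (- x) p
     + - c / y ^+ 2 * qterm q 1 0 0 1 1 (- x) p).
pose Phi p := c / (y ^+ 2 * (y - x)) * qterm q 1 0 0 0 (1 - y) (y - x) p
   + (- c / (x * y) * qterm q 1 (-1) 0 1 1 (- x) p
     + (c / (x ^+ 2 * y) + c / (x * y ^+ 2)) * qterm q 1 0 0 0 1 (- x) p).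
have yx0 : y - x != 0 by rewrite subr_eq0 eq_sym.
have pos p r : simplex2 (p, r) -> 0 < 1 - x * p + - y * r.
  by move=> /(simplex2_affine_gt0 x1 y1); rewrite mulNr.
have pos1 p := @edge_r0_gt0 _ x p x1.
have pos2 p := @hypotenuse_gt0 _ x y p x1 y1.
have HG p : H p (1 - p) - H p 0 = G p.
  rewrite /H /G /qterm.
  have -> : 1 - x * p + - y * (1 - p) = 1 - y + (y - x) * p by ring.
  have -> : 1 - x * p + - y * 0 = 1 + - x * p by ring.
  by field.
transitivity (Phi 1 - Phi 0); last first.
  rewrite /Phi /qterm /c.
  have -> : 1 - y + (y - x) * 1 = 1 - x by ring.
  have -> : 1 - y + (y - x) * 0 = 1 - y by ring.
  have -> : 1 + - x * 1 = 1 - x by ring.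
  have -> : 1 + - x * 0 = 1 by ring.
  have h4 : pochhammer q 3 != 0 by rewrite gt_eqF// pochhammer_gt0.
  by field; rewrite x0 y0 yx0 h4.
apply: (@integral_simplex2 _ _ h H Phi).
- exact: measurable_appell_integrand.
- exact: appell_integrand_ge0.
- move=> p r [/= p0 r0 pr].
  rewrite /appell_integrand /= powRN_dpowR//.
  rewrite (_ : 1 - 1 = 0); last by ring.
  rewrite (_ : 4 - 1 - 1 - 1 = 1); last by ring.
  rewrite !powRr0 powRr1; last by lra.
  have -> : 1 - x * p - y * r = 1 - x * p + - y * r by ring.
  by rewrite /h /c /qterm; ring.
- move=> p r /pos prS.
  apply: is_derive_eq (is_derive_lin (- c / y)
      (is_derive_qterm q (1 - p) (-1) 0 2 prS)
    (is_derive_lin1 (c / y ^+ 2) (is_derive_qterm q 1 0 0 1 prS))) _.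
  by rewrite /h /qterm; field.
- move=> p r /pos prS.
  have := is_derive_lin1 c (is_derive_qterm q (1 - p) (-1) 0 3 prS).
  exact: is_derive_continuous.
- move=> p p01; rewrite HG.
  apply: is_derive_eq (is_derive_lin _ (is_derive_qterm q 1 0 0 0 (pos2 p p01))
    (is_derive_lin _ (is_derive_qterm q 1 (-1) 0 1 (pos1 p p01))
      (is_derive_lin1 _ (is_derive_qterm q 1 0 0 0 (pos1 p p01))))) _.
  by rewrite /G /qterm; field; rewrite x0 y0 yx0.
- move=> p p01; rewrite (funext HG).
  have := is_derive_lin (c / y ^+ 2) (is_derive_qterm q 1 0 0 1 (pos2 p p01))
    (is_derive_lin (c / y) (is_derive_qterm q 1 (-1) 0 2 (pos1 p p01))
      (is_derive_lin1 (- c / y ^+ 2) (is_derive_qterm q 1 0 0 1 (pos1 p p01)))).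
  exact: is_derive_continuous.
Qed.

(** The weight is the general quadratic one that vanishes on the hypotenuse and
    is homogeneous in 1 - p and r; (mu, nu) = (1, -1) and (0, 1) give the two
    weights (1 - p - r)^2 and r (1 - p - r) of the Appell functions below. *)
Lemma simplex_integral_quadratic (R : realType) (q x y c mu nu : R)
    (f : R * R -> R) : 0 < q ->
  x < 1 -> y < 1 -> x != 0 -> y != 0 -> x != y ->
  measurable_fun [set: measurableTypeR R * measurableTypeR R] f ->
  (forall z, 0 <= f z) ->
  (forall p r, simplex2 (p, r) -> f (p, r) =
     c * ((1 - p - r) * (mu * (1 - p) + nu * r)
            * dpowR q 4 (1 - x * p - y * r))) ->
  \int[(@lebesgue_measure R \x @lebesgue_measure R)%E]_(z in @simplex2 R) f z
  =
  c * ((dpowR q 0 (1 - x) - dpowR q 0 (1 - y)) *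
        ((mu + nu) / (y ^+ 2 * (y - x) ^+ 2) + 2 * nu / (y ^+ 3 * (y - x)))
       + (dpowR q 0 (1 - x) - dpowR q 0 1) *
        (2 * nu / (x * y ^+ 3) + (nu - mu) / (x ^+ 2 * y ^+ 2)
          - 2 * mu / (x ^+ 3 * y))
       - (mu + nu) / (y ^+ 2 * (y - x)) * dpowR q 1 (1 - y)
       + (mu / (x * y)) * dpowR q 2 1
       - (2 * mu / (x ^+ 2 * y) - (nu - mu) / (x * y ^+ 2)) * dpowR q 1 1).
Proof.
move=> q0 x1 y1 x0 y0 xy mf f0 fE.
(* H p and Phi are the primitives of h p and of G that integration by parts
   produces when it is repeated until the polynomial factor is constant. *)
pose h p r := c * qterm q (mu * (1 - p) ^+ 2) ((nu - mu) * (1 - p)) (- nu)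
   4 (1 - x * p) (- y) r.
pose H p r :=
   - c / y * qterm q (mu * (1 - p) ^+ 2) ((nu - mu) * (1 - p)) (- nu)
       3 (1 - x * p) (- y) r
   + (- c / y ^+ 2 * qterm q ((nu - mu) * (1 - p)) (- 2 * nu) 0
       2 (1 - x * p) (- y) r
     + 2 * nu * c / y ^+ 3 * qterm q 1 0 0 1 (1 - x * p) (- y) r).
pose G p :=
   c / y ^+ 2 * qterm q (mu + nu) (- (mu + nu)) 0 2 (1 - y) (y - x) p
   + (2 * nu * c / y ^+ 3 * qterm q 1 0 0 1 (1 - y) (y - x) p
   + (mu * c / y * qterm q 1 (- 2) 1 3 1 (- x) p
   + (c / y ^+ 2 * qterm q (nu - mu) (mu - nu) 0 2 1 (- x) p
     + - (2 * nu * c / y ^+ 3) * qterm q 1 0 0 1 1 (- x) p))).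
pose Phi p :=
   c / (y ^+ 2 * (y - x))
      * qterm q (mu + nu) (- (mu + nu)) 0 1 (1 - y) (y - x) p
   + (c * ((mu + nu) / (y ^+ 2 * (y - x) ^+ 2) + 2 * nu / (y ^+ 3 * (y - x)))
        * qterm q 1 0 0 0 (1 - y) (y - x) p
   + (- (mu * c / (x * y)) * qterm q 1 (- 2) 1 2 1 (- x) p
   + (c * (2 * mu / (x ^+ 2 * y) - (nu - mu) / (x * y ^+ 2))
        * qterm q 1 (- 1) 0 1 1 (- x) p
     + c * (2 * nu / (x * y ^+ 3) + (nu - mu) / (x ^+ 2 * y ^+ 2)
          - 2 * mu / (x ^+ 3 * y)) * qterm q 1 0 0 0 1 (- x) p))).
have yx0 : y - x != 0 by rewrite subr_eq0 eq_sym.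
have pos p r : simplex2 (p, r) -> 0 < 1 - x * p + - y * r.
  by move=> /(simplex2_affine_gt0 x1 y1); rewrite mulNr.
have pos1 p := @edge_r0_gt0 _ x p x1.
have pos2 p := @hypotenuse_gt0 _ x y p x1 y1.
have HG p : H p (1 - p) - H p 0 = G p.
  rewrite /H /G /qterm.
  have -> : 1 - x * p + - y * (1 - p) = 1 - y + (y - x) * p by ring.
  have -> : 1 - x * p + - y * 0 = 1 + - x * p by ring.
  by field.
transitivity (Phi 1 - Phi 0); last first.
  rewrite /Phi /qterm.
  have -> : 1 - y + (y - x) * 1 = 1 - x by ring.
  have -> : 1 - y + (y - x) * 0 = 1 - y by ring.
  have -> : 1 + - x * 1 = 1 - x by ring.
  have -> : 1 + - x * 0 = 1 by ring.
  by ring.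
apply: (@integral_simplex2 _ _ h H Phi).
- exact: mf.
- exact: f0.
- move=> p r prS; rewrite fE//.
  have -> : 1 - x * p - y * r = 1 - x * p + - y * r by ring.
  by rewrite /h /qterm; ring.
- move=> p r /pos prS.
  apply: is_derive_eq (is_derive_lin _
      (is_derive_qterm q (mu * (1 - p) ^+ 2) ((nu - mu) * (1 - p)) (- nu) 3 prS)
    (is_derive_lin _
      (is_derive_qterm q ((nu - mu) * (1 - p)) (- 2 * nu) 0 2 prS)
      (is_derive_lin1 _ (is_derive_qterm q 1 0 0 1 prS)))) _.
  by rewrite /h /qterm; field.
- move=> p r /pos prS.
  have := is_derive_lin1 c (is_derive_qterm q (mu * (1 - p) ^+ 2)
    ((nu - mu) * (1 - p)) (- nu) 4 prS).
  exact: is_derive_continuous.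
- move=> p p01; rewrite HG.
  have u1 := pos1 p p01; have u2 := pos2 p p01.
  apply: is_derive_eq
    (is_derive_lin _ (is_derive_qterm q (mu + nu) (- (mu + nu)) 0 1 u2)
    (is_derive_lin _ (is_derive_qterm q 1 0 0 0 u2)
    (is_derive_lin _ (is_derive_qterm q 1 (- 2) 1 2 u1)
    (is_derive_lin _ (is_derive_qterm q 1 (- 1) 0 1 u1)
      (is_derive_lin1 _ (is_derive_qterm q 1 0 0 0 u1)))))) _.
  by rewrite /G /qterm; field; rewrite x0 y0 yx0.
- move=> p p01; rewrite (funext HG).
  have u1 := pos1 p p01; have u2 := pos2 p p01.
  have :=
    (is_derive_lin (c / y ^+ 2)
      (is_derive_qterm q (mu + nu) (- (mu + nu)) 0 2 u2)
    (is_derive_lin (2 * nu * c / y ^+ 3) (is_derive_qterm q 1 0 0 1 u2)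
    (is_derive_lin (mu * c / y) (is_derive_qterm q 1 (- 2) 1 3 u1)
    (is_derive_lin (c / y ^+ 2) (is_derive_qterm q (nu - mu) (mu - nu) 0 2 u1)
      (is_derive_lin1 (- (2 * nu * c / y ^+ 3))
        (is_derive_qterm q 1 0 0 1 u1)))))).
  exact: is_derive_continuous.
Qed.

(** * The Appell functions *)

Lemma appellF1_1_1_4 (R : realType) (q x y : R) : 0 < q ->
  x < 1 -> y < 1 -> x != 0 -> y != 0 -> x != y ->
  appellF1 (q + 3) 1 1 4 x y = 6 * - (pochhammer q 3)^-1 *
   (dpowR q 0 (1 - x)
      * ((x * y ^+ 2)^-1 + (x ^+ 2 * y)^-1 + ((y - x) * y ^+ 2)^-1)
    - dpowR q 0 (1 - y) / ((y - x) * y ^+ 2)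
    - dpowR q 0 1 * ((x * y ^+ 2)^-1 + (x ^+ 2 * y)^-1)
    + dpowR q 1 1 / (x * y)).
Proof.
move=> q0 x1 y1 x0 y0 xy; rewrite /appellF1 -/(appell_integrand _ _ _ _ _ _).
rewrite simplex_integral_linear//.
have G4 : Gamma 4 = 6 :> R by exact: (@Gamma_natr _ 4 3).
have G2 : Gamma (4 - 1 - 1) = 1 :> R by apply: (@Gamma_natr _ _ 1); ring.
by rewrite G4 G2 Gamma1 !mulr1 divr1 mulrA.
Qed.

Lemma appellF1_1_1_5 (R : realType) (q x y : R) : 0 < q ->
  x < 1 -> y < 1 -> x != 0 -> y != 0 -> x != y ->
  appellF1 (q + 4) 1 1 5 x y = 12 / pochhammer q 4 * (
    (dpowR q 0 1 - dpowR q 0 (1 - x)) * 2 *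
        ((x * y ^+ 3)^-1 + (x ^+ 2 * y ^+ 2)^-1 + (x ^+ 3 * y)^-1)
   + (dpowR q 0 (1 - y) - dpowR q 0 (1 - x)) * 2 / (y ^+ 3 * (y - x))
   + dpowR q 2 1 / (x * y)
   - dpowR q 1 1 * 2 * ((x ^+ 2 * y)^-1 + (x * y ^+ 2)^-1)).
Proof.
move=> q0 x1 y1 x0 y0 xy; rewrite /appellF1 -/(appell_integrand _ _ _ _ _ _).
rewrite (@simplex_integral_quadratic _ q x y (pochhammer q 4)^-1 1 (-1))//.
- have G5 : Gamma 5 = 24 :> R by exact: (@Gamma_natr _ 5 4).
  have G3 : Gamma (5 - 1 - 1) = 2 :> R by apply: (@Gamma_natr _ _ 2); ring.
  rewrite G5 G3 Gamma1.
  have yx0 : y - x != 0 by rewrite subr_eq0 eq_sym.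
  have h4 : pochhammer q 4 != 0 by rewrite gt_eqF// pochhammer_gt0.
  by field; rewrite x0 y0 yx0 h4.
- exact: measurable_appell_integrand.
- exact: appell_integrand_ge0.
- move=> p r [/= p0 r0 pr]; rewrite /appell_integrand /= powRN_dpowR//.
  rewrite (_ : 1 - 1 = 0); last by ring.
  rewrite (_ : 5 - 1 - 1 - 1 = 2%:R); last by ring.
  rewrite !powRr0 powR_mulrn; last by lra.
  by ring.
Qed.

Lemma appellF1_1_2_5 (R : realType) (q x y : R) : 0 < q ->
  x < 1 -> y < 1 -> x != 0 -> y != 0 -> x != y ->
  appellF1 (q + 4) 1 2 5 x y = 24 / pochhammer q 4 * (
    (dpowR q 0 (1 - x) - dpowR q 0 (1 - y)) *
        ((y ^+ 2 * (y - x) ^+ 2)^-1 + 2 / (y ^+ 3 * (y - x)))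
    + (dpowR q 0 (1 - x) - dpowR q 0 1) *
        (2 / (x * y ^+ 3) + (x ^+ 2 * y ^+ 2)^-1)
    - dpowR q 1 (1 - y) / (y ^+ 2 * (y - x))
    + dpowR q 1 1 / (x * y ^+ 2)).
Proof.
move=> q0 x1 y1 x0 y0 xy; rewrite /appellF1 -/(appell_integrand _ _ _ _ _ _).
rewrite (@simplex_integral_quadratic _ q x y (pochhammer q 4)^-1 0 1)//.
- have G5 : Gamma 5 = 24 :> R by exact: (@Gamma_natr _ 5 4).
  have G2 : Gamma 2 = 1 :> R by exact: (@Gamma_natr _ 2 1).
  have G2' : Gamma (5 - 1 - 2) = 1 :> R by apply: (@Gamma_natr _ _ 1); ring.
  rewrite G5 G2' G2 Gamma1.
  have yx0 : y - x != 0 by rewrite subr_eq0 eq_sym.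
  have h4 : pochhammer q 4 != 0 by rewrite gt_eqF// pochhammer_gt0.
  by field; rewrite x0 y0 yx0 h4.
- exact: measurable_appell_integrand.
- exact: appell_integrand_ge0.
- move=> p r [/= p0 r0 pr]; rewrite /appell_integrand /= powRN_dpowR//.
  rewrite (_ : 1 - 1 = 0); last by ring.
  rewrite (_ : 2 - 1 = 1); last by ring.
  rewrite (_ : 5 - 1 - 2 - 1 = 1); last by ring.
  rewrite !powRr0 !powRr1//; last by lra.
  by ring.
Qed.

(** * The spectral functions *)

Lemma K_closed_form (R : realType) (q s : R) : 0 < q -> 0 < s -> s != 1 ->
  K_Delta_k s (2 * (q + 1)) =
    - 8 * s `^ (- (q + 1))
    * ((2 * (q + 1) * (s - 1) - 4 * s) * s `^ (q + 1)
       + s * (2 * (q + 1) * (s - 1) + 4))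
    * Gamma (q + 3)
    / (2 * q * (2 * (q + 1)) ^+ 2 * (2 * (q + 2)) * (s - 1) ^+ 3).
Proof.
move=> q0 s0 s1; rewrite /K_Delta_k.
have mE : 2 * (q + 1) / 2 = q + 1 by field.
have x1 : 1 - s < 1 by lra.
have x0 : 1 - s != 0 by rewrite subr_eq0 eq_sym.
rewrite mE.
have a2 : q + 1 + 1 = q + 2%:R by ring.
have c2 : 3 = 1 + 2%:R :> R by ring.
have a3 : q + 1 + 2 = q + 3%:R by ring.
have c3 : 4 = 1 + 3%:R :> R by ring.
rewrite (hyp2F1_closed_form a2 c2 q0 x1 x0) (hyp2F1_closed_form a3 c3 q0 x1 x0).
rewrite !pseriesS pseries0 !binom_coefS binom_coef0 !pochhammerS pochhammer0.
have -> : Gamma (q + 1 + 1) = q * (q + 1) * Gamma q.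
  by rewrite !Gamma_rec ?addr_gt0//; ring.
have G3 : Gamma (q + 1 + 1 + 1) = q * (q + 1) * (q + 2) * Gamma q.
  by rewrite !Gamma_rec ?addr_gt0//; ring.
rewrite (_ : q + 1 + 2 = q + 1 + 1 + 1); last by ring.
rewrite [q + 3](_ : _ = q + 1 + 1 + 1); last by ring.
rewrite G3 !powRN powRD; last by rewrite (lt0r_neq0 s0) implybT.
rewrite powRr1 ?ltW// (_ : 1 - (1 - s) = s); last by ring.
move: (s `^ q) (lt0r_neq0 (powR_gt0 q s0)) (Gamma q) => P P0 G.
have q1 : q + 1 != 0 by rewrite gt_eqF ?addr_gt0.
have q2 : q + 2 != 0 by rewrite gt_eqF ?addr_gt0.
have qn0 := lt0r_neq0 q0.
have sn0 := lt0r_neq0 s0.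
have s10 : s - 1 != 0 by rewrite subr_eq0.
have f2 : 2`! = 2%N by [].
have f3 : 3`! = 6%N by [].
rewrite f2 f3.
field.
by rewrite q1 q2 qn0 sn0 s10 P0 x0.
Qed.

Lemma H_closed_form (R : realType) (q s t : R) : 0 < q -> 0 < s -> 0 < t ->
  s != 1 -> t != 1 -> s * t != 1 ->
  H_Delta_k s t (2 * (q + 1)) =
    2 * Gamma q
    / (2 * (q + 1) * (s - 1) ^+ 2 * (t - 1) ^+ 2 * (s * t - 1) ^+ 3)
    * (2 * s `^ (- (q + 1)) * (s * t - 1) ^+ 3
       + 2 * (t - 1) ^+ 2
         * ((q + 1) * (s - 1) * (s * t - 1) + s * (1 - 2 * s) * t + 1)
       - 2 * (s - 1) ^+ 2 * t * (s * t) `^ (- (q + 1))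
         * ((q + 1) * (t - 1) * (s * t - 1) + s * t ^+ 2 + t - 2)).
Proof.
move=> q0 s0 t0 s1 t1 st1; rewrite /H_Delta_k.
have st0 : 0 < s * t by rewrite mulr_gt0.
have mE : 2 * (q + 1) / 2 = q + 1 by field.
rewrite mE.
have x1 : 1 - s * t < 1 by lra.
have y1 : 1 - s < 1 by lra.
have x0 : 1 - s * t != 0 by rewrite subr_eq0 eq_sym.
have y0 : 1 - s != 0 by rewrite subr_eq0 eq_sym.
have t10 : t - 1 != 0 by rewrite subr_eq0.
have xy' : (1 - s) - (1 - s * t) != 0.
  have -> : (1 - s) - (1 - s * t) = s * (t - 1) by ring.
  by rewrite mulf_neq0// lt0r_neq0.
have xy : 1 - s * t != 1 - s by rewrite eq_sym -subr_eq0.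
rewrite (_ : q + 1 + 2 = q + 3); last by ring.
rewrite (_ : q + 1 + 3 = q + 4); last by ring.
rewrite appellF1_1_1_4// appellF1_1_1_5// appellF1_1_2_5//.
rewrite !(Gamma_shift _ q0).
rewrite (_ : 1 - (1 - s) = s); last by ring.
rewrite (_ : 1 - (1 - s * t) = s * t); last by ring.
(* All powers are expressed through the exponent of the conclusion. *)
have g0 u : 0 < u -> dpowR q 0 u = u * u `^ (- (q + 1)).
  move=> u0; rewrite /dpowR expr0 pochhammer0 !mul1r addr0 opprD powRB;
    last first.
    by rewrite (lt0r_neq0 u0) implybT.
  by rewrite powRr1 ?ltW//; field; rewrite gt_eqF.
have g1 u : dpowR q 1 u = - q * u `^ (- (q + 1)).
  by rewrite /dpowR pochhammerS pochhammer0 expr1; ring.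
have g2 : dpowR q 2 1 = q * (q + 1).
  by rewrite /dpowR powR1 !pochhammerS pochhammer0; ring.
rewrite g2 !g0// !g1 !powR1 ?ltr01//.
rewrite !pochhammerS !pochhammer0.
move: (s `^ _) ((s * t) `^ _) (Gamma q) => X Y G.
have q1 : q + 1 != 0 by rewrite gt_eqF ?addr_gt0.
have q2 : q + 2 != 0 by rewrite gt_eqF ?addr_gt0.
have q3 : q + 3 != 0 by rewrite gt_eqF ?addr_gt0.
have qn0 := lt0r_neq0 q0.
have s10 : s - 1 != 0 by rewrite subr_eq0.
have st10 : s * t - 1 != 0 by rewrite subr_eq0.
field.
by rewrite st10 t10 s10 q1 y0 x0 xy' q3 q2 qn0.
Qed.

Theorem proposition4p7 (R : realType) (m : R) (hm : 2 < m) :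
  (forall s : R, 0 < s -> s != 1 ->
     K_Delta_k s m =
       - 8 * s `^ (- (m / 2))
       * ((m * (s - 1) - 4 * s) * s `^ (m / 2) + s * (m * (s - 1) + 4))
       * Gamma (m / 2 + 2)
       / ((m - 2) * m ^+ 2 * (m + 2) * (s - 1) ^+ 3))
  /\
  (forall s t : R, 0 < s -> 0 < t -> s != 1 -> t != 1 -> s * t != 1 ->
     H_Delta_k s t m =
       2 * Gamma (m / 2 - 1)
       / (m * (s - 1) ^+ 2 * (t - 1) ^+ 2 * (s * t - 1) ^+ 3)
       * (2 * s `^ (- (m / 2)) * (s * t - 1) ^+ 3
          + 2 * (t - 1) ^+ 2
            * (m / 2 * (s - 1) * (s * t - 1) + s * (1 - 2 * s) * t + 1)
          - 2 * (s - 1) ^+ 2 * t * (s * t) `^ (- (m / 2))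
            * (m / 2 * (t - 1) * (s * t - 1) + s * t ^+ 2 + t - 2))).
Proof.
pose q := m / 2 - 1.
have q0 : 0 < q by rewrite /q; lra.
have mE : m = 2 * (q + 1) by rewrite /q; field.
have m2 : m / 2 = q + 1 by rewrite /q; ring.
split=> [s s0 s1|s t s0 t0 s1 t1 st1].
  rewrite [K_Delta_k s m](_ : _ = K_Delta_k s (2 * (q + 1))); last first.
    by rewrite -mE.
  rewrite K_closed_form// m2 (_ : q + 1 + 2 = q + 3); last by ring.
  rewrite (_ : 2 * q = m - 2); last by rewrite /q; field.
  rewrite (_ : 2 * (q + 2) = m + 2); last by rewrite /q; field.
  by rewrite -mE.
rewrite [H_Delta_k s t m](_ : _ = H_Delta_k s t (2 * (q + 1))); last first.
  by rewrite -mE.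
by rewrite -/q H_closed_form// m2 -mE.
Qed.
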